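(* Let $\Gamma_3^2,\Gamma_3^3$ be the coefficients, depending on $H$, of the projection $\mathbb{E}(\Delta_1\mid\Delta_2,\Delta_3)=\Gamma_3^2\Delta_2+\Gamma_3^3\Delta_3$ for fractional Gaussian noise $(\Delta_k)$ with Hurst index $H$, as defined in the context. Then for any $H\in(\tfrac12,1)$, $$\Gamma_3^2>\Gamma_3^3>0.$$
   Context: Let $B^H=\{B^H_t,t\ge0\}$ be a fractional Brownian motion with Hurst index $H$, i.e. a centred Gaussian process with covariance $\tfrac12(t^{2H}+s^{2H}-|t-s|^{2H})$, and let $\Delta_n=B^H_n-B^H_{n-1}$, $n\ge 1$, be its increments (fractional Gaussian noise). They form a stationary Gaussian sequence with autocovariance $\rho_k=\mathbb{E}\Delta_1\Delta_{k+1}=\tfrac12(|k+1|^{2H}-2|k|^{2H}+|k-1|^{2H})$, $k\ge 0$ (so $\rho_0=1$). For $n\ge 2$ the real coefficients $\Gamma_n^k$, $2\le k\le n$, are defined by $\mathbb{E}(\Delta_1\mid\Delta_2,\dots,\Delta_n)=\sum_{k=2}^n\Gamma_n^k\Delta_k$; equivalently, they are the unique solution of the linear system $\rho_{l-1}=\sum_{k=2}^n\Gamma_n^k\rho_{|l-k|}$, $2\le l\le n$ (whose coefficient matrix is nonsingular). *)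

(* Defs.v *)
From HB Require Import structures.
From mathcomp Require Import all_boot all_order all_algebra.
From mathcomp Require Import all_classical all_reals all_analysis.

Set Implicit Arguments.
Unset Strict Implicit.
Unset Printing Implicit Defensive.

Import Order.TTheory GRing.Theory Num.Theory.
Import numFieldNormedType.Exports.

Local Open Scope classical_set_scope.
Local Open Scope ring_scope.

(* Degenerate (Dirac) laws count as Gaussian; they need a separate clause
   because [normal_prob m 0] is by convention the uniform law on [0, 1]. *)
Definition gaussian_law (R : realType) (d : measure_display)
    (T : measurableType d) (P : probability T R) (X : T -> R) : Prop :=
  (exists m s : R, s != 0 /\
     forall V : set R, measurable V -> P (X @^-1` V) = normal_prob m s V) \/
  (exists m : R,
     forall V : set R, measurable V -> P (X @^-1` V) = \d_m V).

(* Processes are indexed by all of [R], but only times [t >= 0] matter. *)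
Definition gaussian_process (R : realType) (d : measure_display)
    (T : measurableType d) (P : probability T R)
    (B : R -> {RV P >-> R}) : Prop :=
  forall (n : nat) (t c : 'I_n -> R), (forall i, 0 <= t i) ->
    gaussian_law P (fun w => \sum_(i < n) c i * B (t i) w).

Definition fBm (R : realType) (d : measure_display)
    (T : measurableType d) (P : probability T R) (H : R)
    (B : R -> {RV P >-> R}) : Prop :=
  [/\ gaussian_process B,
      forall t : R, 0 <= t -> ('E_P[B t] = 0)%E
    & forall s t : R, 0 <= s -> 0 <= t ->
        covariance P (B s) (B t) =
        (2^-1 * (t `^ (2 * H) + s `^ (2 * H) - `|t - s| `^ (2 * H)))%:E].

(* Meaningful for [n >= 1]. *)
Definition fGn (R : realType) (d : measure_display)
    (T : measurableType d) (P : probability T R)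
    (B : R -> {RV P >-> R}) (n : nat) : T -> R :=
  fun w => B n%:R w - B n.-1%:R w.

(* [Y] is a version of the conditional expectation of the integrable variable
   [X] given the sub-sigma-algebra [G]. *)
Definition is_cond_expectation (R : realType) (d : measure_display)
    (T : measurableType d) (P : probability T R)
    (X : T -> R) (G : set (set T)) (Y : T -> R) : Prop :=
  [/\ forall V : set R, measurable V -> G (Y @^-1` V),
      P.-integrable setT (EFin \o Y)
    & forall A, G A ->
        (\int[P]_(w in A) (Y w)%:E = \int[P]_(w in A) (X w)%:E)%E].

Definition sigma_fGn (R : realType) (d : measure_display)
    (T : measurableType d) (P : probability T R)
    (B : R -> {RV P >-> R}) (n : nat) : set (set T) :=
  <<s \bigcup_(k in [set k | (2 <= k <= n)%N])
        preimage_set_system setT (fGn B k) measurable >>.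

(* The values [Gamma k], [2 <= k <= n], are the coefficients of
   the conditional expectation of Delta_1 given Delta_2, ..., Delta_n. *)
Definition fGn_projection_coef (R : realType) (d : measure_display)
    (T : measurableType d) (P : probability T R)
    (B : R -> {RV P >-> R}) (n : nat) (Gamma : nat -> R) : Prop :=
  is_cond_expectation P (fGn B 1) (sigma_fGn B n)
    (fun w => \sum_(2 <= k < n.+1) Gamma k * fGn B k w).

(* Main.v *)
(** The normal equations [E[(X - E[X|G]) Z] = 0], for square integrable
    [G]-measurable [Z], give [rho_1 = Gamma_2 + rho_1 Gamma_3] and
    [rho_2 = rho_1 Gamma_2 + Gamma_3].  Hence
    [(Gamma_2 - Gamma_3) (1 - rho_1) = rho_1 - rho_2] and
    [Gamma_3 (1 - rho_1^2) = rho_2 - rho_1^2], so it suffices that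
    [0 < rho_1 < 1] and [rho_1^2 < rho_2 < rho_1].  With [a = 2H] these two
    inequalities on [rho_2] read [2 * 3^a > 4^a + 2] and [3^a < 3 * 2^a - 3]
    on [1 < a < 2].  After division by [3^a], resp. [2^a], they say that a
    strictly concave function of [a] vanishing at [a = 1] and [a = 2] is
    positive in between, i.e. that each of the exponentials involved lies
    strictly below its chord on [1, 2]. *)

Require Import Defs.
From HB Require Import structures.
From mathcomp Require Import all_boot all_order all_algebra.
From mathcomp Require Import finmap.
From mathcomp Require Import all_classical all_reals all_analysis.
From mathcomp Require Import measurable_realfun ring lra.

Import Order.TTheory GRing.Theory Num.Theory.
Import numFieldNormedType.Exports.

Local Open Scope classical_set_scope.
Local Open Scope ring_scope.

(** * Strict chord inequalities for powers *)

Lemma powR_lt_bernoulli (R : realType) (c t : R) : 0 < c -> c != 1 ->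
  0 < t < 1 -> c `^ t < 1 + t * (c - 1).
Proof.
move=> c0 c1 /andP[t0 t1].
have cE : c = expR (ln c) by rewrite lnK// posrE.
rewrite {1}/powR gt_eqF//; set L := ln c in cE *.
have L0 : L != 0.
  by apply: contra_neq c1 => L0; rewrite cE L0 expR0.
have m0 : - (t * L) != 0 by rewrite oppr_eq0 mulf_neq0// gt_eqF.
have n0 : (1 - t) * L != 0 by rewrite mulf_neq0// gt_eqF// subr_gt0.
(* [expR] lies strictly above its tangent at [t * L]; average at [0], [L]. *)
have h1 := expR_gt1Dx m0; have h2 := expR_gt1Dx n0.
have e0 := expR_gt0 (t * L).
have -> : c = expR (t * L) * expR ((1 - t) * L).
  by rewrite -expRD -mulrDl addrC subrK mul1r.
have k : expR (t * L) * expR (- (t * L)) = 1 by rewrite -expRD subrr expR0.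
set E := expR (t * L) in e0 k *.
have p1 : E * (1 + - (t * L)) < 1 by rewrite -[ltRHS]k ltr_pM2l.
have p2 : E * (1 + (1 - t) * L) < E * expR ((1 - t) * L) by rewrite ltr_pM2l.
(* With weights [1 - t] and [t] the terms linear in [L] cancel, which leaves
   [E < (1 - t) + t * c]. *)
have q1 : (1 - t) * (E * (1 + - (t * L))) < (1 - t) * 1.
  by rewrite ltr_pM2l// subr_gt0.
have q2 : t * (E * (1 + (1 - t) * L)) < t * (E * expR ((1 - t) * L)).
  by rewrite ltr_pM2l.
nra.
Qed.

(* The right-hand side is the chord of [a |-> c `^ a] over [1, 2]. *)
Lemma powR_lt_chord (R : realType) (c a : R) : 0 < c -> c != 1 ->
  1 < a < 2 -> c `^ a < c * (1 + (a - 1) * (c - 1)).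
Proof.
move=> c0 c1 /andP[a1 a2].
rewrite -(@mulr_powRB1 _ c a) ?(ltW c0)//; last by lra.
rewrite ltr_pM2l// powR_lt_bernoulli//; lra.
Qed.

Section exponential_inequalities.
Context {R : realType}.
Implicit Type a : R.

Let powRdiv (b c a : R) : 0 < b -> 0 < c -> (b / c) `^ a * c `^ a = b `^ a.
Proof.
by move=> b0 c0; rewrite -powRM ?divfK ?gt_eqF ?divr_ge0// ltW.
Qed.

(** Divided by 2^a this is (3/2)^a + 3 (1/2)^a < 3, and the chords of the two terms add up to the
    constant 3. *)
Lemma powR3_lt_powR2 a : 1 < a < 2 -> 3 `^ a < 3 * 2 `^ a - 3.
Proof.
move=> a12.
have h1 : (3 / 2) `^ a < 3 / 2 * (1 + (a - 1) * (3 / 2 - 1)) :> R.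
  by apply: powR_lt_chord => //; lra.
have h2 : (1 / 2) `^ a < 1 / 2 * (1 + (a - 1) * (1 / 2 - 1)) :> R.
  by apply: powR_lt_chord => //; lra.
have := @powRdiv 3 2 a ltac:(lra) ltac:(lra).
have := @powRdiv 1 2 a ltac:(lra) ltac:(lra).
rewrite powR1.
have : 0 < 2 `^ a :> R by exact: powR_gt0.
nra.
Qed.

(** Divided by 3^a this is (4/3)^a + 2 (1/3)^a < 2, and the chords of the two terms add up to the
    constant 2. *)
Lemma powR4_lt_powR3 a : 1 < a < 2 -> (2 `^ a) ^+ 2 + 2 < 2 * 3 `^ a.
Proof.
move=> a12.
have h1 : (4 / 3) `^ a < 4 / 3 * (1 + (a - 1) * (4 / 3 - 1)) :> R.
  by apply: powR_lt_chord => //; lra.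
have h2 : (1 / 3) `^ a < 1 / 3 * (1 + (a - 1) * (1 / 3 - 1)) :> R.
  by apply: powR_lt_chord => //; lra.
have := @powRdiv 4 3 a ltac:(lra) ltac:(lra).
have := @powRdiv 1 3 a ltac:(lra) ltac:(lra).
have -> : 4 `^ a = (2 `^ a) ^+ 2 :> R.
  by rewrite expr2 -powRM//; congr (_ `^ _); lra.
rewrite powR1.
have : 0 < 3 `^ a :> R by exact: powR_gt0.
nra.
Qed.

(** This will give 0 < rho_1 < 1. The chord of 2^a is 2a < 4; that of (1/2)^a stays below 1/2. *)
Lemma powR2_bounds a : 1 < a < 2 -> (2 : R) < 2 `^ a < 4.
Proof.
move=> a12.
have h1 : 2 `^ a < 2 * (1 + (a - 1) * (2 - 1)) :> R.
  by apply: powR_lt_chord => //; lra.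
have h2 : (1 / 2) `^ a < 1 / 2 * (1 + (a - 1) * (1 / 2 - 1)) :> R.
  by apply: powR_lt_chord => //; lra.
have := @powRdiv 1 2 a ltac:(lra) ltac:(lra).
rewrite powR1.
have : 0 < 2 `^ a :> R by exact: powR_gt0.
by move=> ? ?; apply/andP; split; nra.
Qed.

End exponential_inequalities.

(** * Orthogonality of [D] to functions of [Z] *)

Section orthogonality.
Context {d d'} {T : measurableType d} {U : measurableType d'} {R : realType}.
Context {mu : {measure set T -> \bar R}} {D : T -> R} {Z : T -> U}.
Hypothesis iD : mu.-integrable setT (EFin \o D).
Hypothesis mZ : measurable_fun setT Z.
Hypothesis D_Z : forall V : set U, measurable V ->
  (\int[mu]_(w in Z @^-1` V) (D w)%:E = 0)%E.

Import HBNNSimple.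

(** Since [phi] has finitely many values, the integrand is a finite combination of restrictions of
    [D] to preimages under [Z], each of integral zero by [D_Z]. *)
Lemma integral_mul_nnsfun_comp (phi : {nnsfun U >-> R}) :
  (\int[mu]_w (D w * phi (Z w))%:E = 0)%E.
Proof.
have mpre (V : set U) : measurable V -> measurable (Z @^-1` V).
  by move=> mV; rewrite -[X in measurable X]setTI; exact: mZ.
set s := fset_set (phi @` setT).
have mI (i : nat) : measurable (Z @^-1` (phi @^-1` [set s`_i])).
  by apply: mpre; exact: measurable_funPTI.
pose f (i : 'I_#|`s|) w : \bar R :=
  ((s`_i)%:E * ((EFin \o D) \_ (Z @^-1` (phi @^-1` [set s`_i])) w))%E.
have fi i : mu.-integrable setT (f i).
  apply: integrableZl => //; rewrite -integrable_mkcond//.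
  exact: integrableS iD.
transitivity (\int[mu]_w \sum_(i < #|`s|) f i w)%E.
  apply: eq_integral => w _.
  rewrite fimfunEord mulr_sumr -sumEFin; apply: eq_bigr => i _.
  rewrite /f patchE indicE.
  rewrite [w \in _](_ : _ = (Z w \in phi @^-1` [set s`_i]))//.
  by case: ifPn => _; rewrite ?mulr1 ?mulr0 ?mule0// -EFinM mulrC.
rewrite integral_sum//; apply: big1 => i _.
rewrite /f integralZl//; last first.
  by rewrite -integrable_mkcond//; exact: integrableS iD.
by rewrite -integral_mkcond D_Z ?mule0//; exact: measurable_funPTI.
Qed.

(** Simple functions increase to [g] and the integrands stay below |D g(Z)|, so dominated
    convergence extends the simple case. *)
Lemma integral_mul_ge0_comp (g : U -> R) : measurable_fun setT g ->
  (forall x, 0 <= g x) ->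
  mu.-integrable setT (fun w => (D w * g (Z w))%:E) ->
  (\int[mu]_w (D w * g (Z w))%:E = 0)%E.
Proof.
move=> mg g0 ig.
have /measurable_EFinP mG := mg.
have G0 (x : U) : setT x -> (0 <= (EFin \o g) x)%E.
  by rewrite lee_fin.
pose p_ := nnsfun_approx measurableT mG.
have mD : measurable_fun setT D by apply/measurable_EFinP; case/integrableP: iD.
have := @dominated_convergence _ _ _ mu setT measurableT
  (fun n w => (D w * p_ n (Z w))%:E) (fun w => (D w * g (Z w))%:E)
  (fun w => `|(D w * g (Z w))%:E|%E).
case.
- move=> n; apply/measurable_EFinP; apply: measurable_funM => //.
  exact: measurableT_comp.
- by case/integrableP: ig.
- apply: aeW => w _.
  rewrite [X in _ --> X]EFinM.
  rewrite [X in X @ _ --> _](_ : _ =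
    (fun n => (D w)%:E * (p_ n (Z w))%:E)%E)//.
  apply: cvgeZl => //.
  exact: (@cvg_nnsfun_approx _ _ _ setT measurableT (EFin \o g) mG G0 (Z w)).
- exact: integrable_abse.
- apply: aeW => w n _.
  rewrite !EFinM !abseM lee_wpmul2l// !gee0_abs ?lee_fin//.
  by rewrite -lee_fin /p_ nnsfun_approxE le_approx.
move=> _ _ cvg_int; apply/esym; apply: (cvg_unique _ _ cvg_int) => //.
apply: cvg_near_cst; apply: nearW => n /=.
exact: integral_mul_nnsfun_comp.
Qed.

(** Split [g] into positive and negative parts; both products with [D] are integrable because each
    part is at most |g|. *)
Lemma integral_mul_comp (g : U -> R) : measurable_fun setT g ->
  mu.-integrable setT (fun w => (D w * g (Z w))%:E) ->
  (\int[mu]_w (D w * g (Z w))%:E = 0)%E.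
Proof.
move=> mg ig.
have mD : measurable_fun setT D by apply/measurable_EFinP; case/integrableP: iD.
have part (h : U -> R) : measurable_fun setT h ->
    (forall x, `|h x| <= `|g x|) ->
    mu.-integrable setT (fun w => (D w * h (Z w))%:E).
  move=> mh hg; apply: le_integrable ig => //.
    apply/measurable_EFinP; apply: measurable_funM => //.
    exact: measurableT_comp.
  by move=> w _; rewrite /= lee_fin !normrM ler_wpM2l.
have mp : measurable_fun setT g^\+ by exact: measurable_funrpos.
have mn : measurable_fun setT g^\- by exact: measurable_funrneg.
have absg x : g^\+ x + g^\- x = `|g x| := congr1 (@^~ x) (funrposDneg g).
have subg x : g^\+ x - g^\- x = g x := congr1 (@^~ x) (funrposBneg g).
have ip : mu.-integrable setT (fun w => (D w * g^\+ (Z w))%:E).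
  apply: part => // x; rewrite ger0_norm ?funrpos_ge0// -absg.
  by rewrite ler_wpDr ?funrneg_ge0.
have ineg : mu.-integrable setT (fun w => (D w * g^\- (Z w))%:E).
  apply: part => // x; rewrite ger0_norm ?funrneg_ge0// -absg.
  by rewrite ler_wpDl ?funrpos_ge0.
transitivity (\int[mu]_w ((D w * g^\+ (Z w))%:E - (D w * g^\- (Z w))%:E))%E.
  by apply: eq_integral => w _; rewrite -EFinB -mulrBr subg.
by rewrite integralB// !integral_mul_ge0_comp ?sube0.
Qed.

End orthogonality.

(** * Covariances and conditional expectation *)

Section square_integrable.
Context {d} {T : measurableType d} {R : realType} {P : probability T R}.

Lemma centered_Lfun2 (X : {RV P >-> R}) (v : R) :
  ('E_P[X] = 0)%E -> covariance P X X = v%:E -> (X : T -> R) \in Lfun P 2%:E.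
Proof.
move=> EX0; rewrite covariance.unlock EX0 /= unlock => varX.
rewrite inE; apply/andP; split; rewrite inE/=; first exact: measurable_funPT.
rewrite /finite_norm Lnorm.unlock /= poweR_lty//.
rewrite [X in (X < _)%E](_ : _ = v%:E) ?ltry//.
rewrite -varX; apply: eq_integral => w _ /=.
by rewrite !fctE /= !subr0 powR_mulrn// real_normK// ?num_real// expr2.
Qed.

(** The difference X - Y integrates to zero over every event of [G], hence over all preimages under
    [Z], so it is orthogonal to [Z] itself. *)
Lemma cond_expectation_covariance (X Y Z : T -> R) (G : set (set T)) :
  is_cond_expectation P X G Y ->
  X \in Lfun P 2%:E -> Y \in Lfun P 2%:E -> Z \in Lfun P 2%:E ->
  (forall V : set R, measurable V -> G (Z @^-1` V)) ->
  covariance P X Z = covariance P Y Z.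
Proof.
move=> [_ _ XY] X2 Y2 Z2 GZ.
have L12 := Lfun_subset12 (fin_num_measure P _ measurableT).
have mZ : measurable_fun setT Z.
  by move: Z2; rewrite inE => /andP[/[!inE]].
have iX : P.-integrable setT (EFin \o X) by apply/Lfun1_integrable/L12.
have iY : P.-integrable setT (EFin \o Y) by apply/Lfun1_integrable/L12.
have XY2 : X \- Y \in Lfun P 2%:E by rewrite rpredB// lee1n.
have iXY : P.-integrable setT (EFin \o (X \- Y)) by apply/Lfun1_integrable/L12.
have XYZ1 : (X \- Y) \* Z \in Lfun P 1 by exact: Lfun2_mul_Lfun1.
have XY_Z (V : set R) : measurable V ->
    (\int[P]_(w in Z @^-1` V) ((X \- Y) w)%:E = 0)%E.
  move=> mV.
  have mZV : measurable (Z @^-1` V).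
    by rewrite -[X in measurable X]setTI; exact: mZ.
  have iX' := integrableS measurableT mZV (@subsetT _ _) iX.
  have iY' := integrableS measurableT mZV (@subsetT _ _) iY.
  rewrite integralB_EFin// XY; last exact: GZ.
  by rewrite subee// integrable_fin_num.
(* The whole space is a preimage under [Z], so X - Y is centred and its covariance with [Z] is just
   E[(X - Y) Z]. *)
have EXY : ('E_P[(X \- Y)%R] = 0)%E.
  by rewrite unlock -(XY_Z setT measurableT) preimage_setT.
have : covariance P (X \- Y) Z = 0%E.
  rewrite (covarianceE (L12 _ XY2) (L12 _ Z2) XYZ1) EXY mul0e sube0 unlock.
  apply: (@integral_mul_comp _ _ _ _ _ P (X \- Y) Z iXY mZ XY_Z id) => //.
  exact/Lfun1_integrable.
rewrite covarianceBl// => /eqP; rewrite sube_eq ?add0e => [/eqP//||].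
  by rewrite covariance_fin_num ?Lfun2_mul_Lfun1// L12.
by rewrite fin_num_adde_defl// covariance_fin_num ?Lfun2_mul_Lfun1// L12.
Qed.

End square_integrable.

(** This is rho_k; the absolute value is there for k = 0, where k - 1 is -1 in [R]. *)
Definition fGn_autocov {R : realType} (H : R) (k : nat) : R :=
  2^-1 * (k.+1%:R `^ (2 * H) - 2 * k%:R `^ (2 * H) + `|k%:R - 1| `^ (2 * H)).

(** * Second moments of fractional Gaussian noise *)

Section fractional_gaussian_noise.
Context {d} {T : measurableType d} {R : realType} {P : probability T R}.
Context {H : R} {B : R -> {RV P >-> R}}.
Hypothesis B_fBm : fBm H B.

Lemma fBm_Lfun2 (t : R) : 0 <= t -> (B t : T -> R) \in Lfun P 2%:E.
Proof.
case: B_fBm => _ EB covB t0.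
exact: centered_Lfun2 (EB t t0) (covB t t t0 t0).
Qed.

Lemma fGn_Lfun2 (n : nat) : fGn B n \in Lfun P 2%:E.
Proof.
rewrite (_ : fGn B n = (B n%:R : T -> R) \- B n.-1%:R)//.
by rewrite rpredB ?lee1n// => *; apply: fBm_Lfun2.
Qed.

(** Bilinearity gives four covariances of [B], in which the powers of single times cancel and only
    time differences, free of [m], remain. Successor indices let [n.-1] reduce. *)
Lemma covariance_fGn (m k : nat) :
  covariance P (fGn B m.+1) (fGn B (m + k).+1) = (fGn_autocov H k)%:E.
Proof.
have [_ _ covB] := B_fBm.
rewrite [fGn B m.+1](_ : _ = (B m.+1%:R : T -> R) \- B m%:R)//.
rewrite [fGn B _](_ : _ = (B (m + k).+1%:R : T -> R) \- B (m + k)%:R)//.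
have L2 n : (B n%:R : T -> R) \in Lfun P 2%:E by exact: fBm_Lfun2.
have dL2 n : (B n.+1%:R : T -> R) \- B n%:R \in Lfun P 2%:E.
  by rewrite rpredB ?lee1n.
rewrite covarianceBl ?covarianceBr// !covB// -!EFinB; congr (_%:E).
have -> : ((m + k).+1%:R - m.+1%:R : R) = k%:R.
  by rewrite -!natr1 natrD; ring.
have -> : ((m + k)%:R - m.+1%:R : R) = k%:R - 1.
  by rewrite -natr1 natrD; ring.
have -> : ((m + k).+1%:R - m%:R : R) = k.+1%:R.
  by rewrite -!natr1 natrD; ring.
have -> : ((m + k)%:R - m%:R : R) = k%:R by rewrite natrD; ring.
by rewrite /fGn_autocov !normr_nat; field.
Qed.

Lemma fGn_sigma_preimage (n k : nat) (V : set R) : (2 <= k <= n)%N ->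
  measurable V -> sigma_fGn B n (fGn B k @^-1` V).
Proof.
move=> kn mV; apply: sub_gen_smallest; exists k => //.
by exists V => //; rewrite setTI.
Qed.

End fractional_gaussian_noise.

(** * The normal equations and the signs of their solution *)

Theorem proposition2p8 (R : realType) (d : measure_display)
    (T : measurableType d) (P : probability T R) (H : R)
    (B : R -> {RV P >-> R}) (Gamma3 : nat -> R)
    (H_range : 2^-1 < H < 1)
    (B_fBm : fBm H B)
    (Gamma3_coef : fGn_projection_coef B 3 Gamma3) :
  Gamma3 2%N > Gamma3 3%N /\ Gamma3 3%N > 0.
Proof.
have a12 : 1 < 2 * H < 2 by lra.
have L2 n := fGn_Lfun2 B_fBm n.
pose Y : T -> R := (Gamma3 2%N \o* fGn B 2) \+ (Gamma3 3%N \o* fGn B 3).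
have YE : (fun w => \sum_(2 <= k < 4) Gamma3 k * fGn B k w) = Y.
  apply/funext => w; rewrite /Y /= big_nat_recl// big_nat1.
  by rewrite ![Gamma3 _ * _]mulrC.
have ZL2 k c : c \o* fGn B k \in Lfun P 2%:E by rewrite Lfun_scale ?L2// ler1n.
have YL2 : Y \in Lfun P 2%:E by rewrite rpredD ?lee1n.
have normal_eq k : (2 <= k <= 3)%N ->
    covariance P (fGn B 1) (fGn B k) =
    ((Gamma3 2%N)%:E * covariance P (fGn B 2) (fGn B k) +
     (Gamma3 3%N)%:E * covariance P (fGn B 3) (fGn B k))%E.
  move=> k23.
  rewrite (@cond_expectation_covariance _ _ _ _ _ Y _ (sigma_fGn B 3))//.
  - have L1 n : fGn B n \in Lfun P 1.
      by apply: Lfun_subset12 (L2 n); exact: fin_num_measure.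
    by rewrite covarianceDl// !covarianceZl// Lfun2_mul_Lfun1.
  - by rewrite -YE.
  - by move=> V; exact: fGn_sigma_preimage.
have := normal_eq 3%N isT; have := normal_eq 2%N isT.
have cov m k : covariance P (fGn B m.+1) (fGn B (m + k).+1) =
    (fGn_autocov H k)%:E.
  exact: covariance_fGn.
(* [cov] expects the earlier increment first, hence the swap. *)
rewrite (covarianceC P (fGn B 3) (fGn B 2)) (cov 0%N 1%N) (cov 0%N 2%N).
rewrite !(cov 1%N 0%N) (cov 1%N 1%N) (cov 2%N 0%N).
rewrite -!EFinM -!EFinD => -[eq2] [eq3].
have [x2 x4] := andP (powR2_bounds _ a12).
have y_lt := powR3_lt_powR2 _ a12.
have y_gt := powR4_lt_powR3 _ a12.
(* A nonzero exponent makes the power of 0 vanish in rho_0 and rho_1. *)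
have a0 : 2 * H != 0 by lra.
have rho0 : fGn_autocov H 0 = 1.
  by rewrite /fGn_autocov powR0// sub0r normrN normr1 powR1; field.
have rho1 : fGn_autocov H 1 = (2 `^ (2 * H) - 2) / 2.
  by rewrite /fGn_autocov subrr normr0 powR0// powR1; field.
have rho2 : fGn_autocov H 2 = (3 `^ (2 * H) - 2 * 2 `^ (2 * H) + 1) / 2.
  rewrite /fGn_autocov (_ : 2%:R - 1 = 1 :> R); last by ring.
  by rewrite normr1 powR1; field.
rewrite rho0 rho1 rho2 in eq2 eq3.
set x := 2 `^ _ in x2 x4 y_lt y_gt eq2 eq3.
set y := 3 `^ _ in y_lt y_gt eq2 eq3.
set r := (x - 2) / 2 in eq2 eq3; set q := (y - 2 * x + 1) / 2 in eq3.
have [r0 r1] : 0 < r /\ r < 1 by rewrite /r; lra.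
have qr : q < r by rewrite /r /q; lra.
have rq : r ^+ 2 < q by rewrite /r /q; lra.
(* [e3] is [eq3] minus [r] times [eq2], which eliminates [Gamma3 2]; [e23] is [eq2] minus [eq3].
   Both are linear once this product is supplied. *)
have req2 := congr1 ( *%R r) eq2.
have e3 : Gamma3 3%N * (1 - r ^+ 2) = q - r ^+ 2 by lra.
have e23 : (Gamma3 2%N - Gamma3 3%N) * (1 - r) = r - q by lra.
split.
  by rewrite -subr_gt0 -(@pmulr_lgt0 _ (1 - r)) ?e23; lra.
by rewrite -(@pmulr_lgt0 _ (1 - r ^+ 2)) ?e3; nra.
Qed.
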